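(* Let $M^{2n+1}(\varphi,Q,\xi,\eta,g)$ be a weak $K$-contact manifold such that $(\nabla\,\mathrm{Ric})(\xi,\cdot)=0$, i.e., $(\nabla_X\mathrm{Ric})(\xi,Y)=0$ for all vector fields $X,Y$ (in particular, this holds if the Ricci tensor is parallel), and such that $\mathrm{trace}\,Q$ is constant. Then $(M,g)$ is an Einstein manifold of scalar curvature $(2n+1)\,\mathrm{trace}\,Q$.
   Context: $\nabla$ is the Levi-Civita connection of $g$, and $\mathrm{Ric}$ is the Ricci tensor of $g$. A weak almost contact structure on a smooth manifold $M^{2n+1}$ is a set $(\varphi,Q,\xi,\eta)$, where $\varphi$ is a $(1,1)$-tensor field, $Q$ is a nonsingular $(1,1)$-tensor field, $\xi$ is a vector field (the Reeb vector field) and $\eta$ is a 1-form with $\eta(\xi)=1$, satisfying $\varphi^2=-Q+\eta\otimes\xi$ and $Q\xi=\xi$; moreover, the distribution $\mathcal D=\ker\eta$ is assumed to be $\varphi$-invariant ($\varphi X\in\mathcal D$ for $X\in\mathcal D$). A weak almost contact metric structure $(\varphi,Q,\xi,\eta,g)$ is a weak almost contact structure together with a Riemannian metric $g$ such that $g(\varphi X,\varphi Y)=g(X,QY)-\eta(X)\eta(Y)$ for all vector fields $X,Y$. A weak contact metric structure is a weak almost contact metric structure such that $\Phi=d\eta$, where $\Phi(X,Y)=g(X,\varphi Y)$ and $d\eta(X,Y)=\frac12\{X(\eta(Y))-Y(\eta(X))-\eta([X,Y])\}$. A weak $K$-contact manifold is a weak contact metric manifold whose Reeb vector field $\xi$ is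 Killing, i.e., $\mathcal L_\xi g=0$. Convention: $\mathrm{trace}\,Q$ denotes the trace over $\mathcal D$, $\mathrm{trace}\,Q=\sum_{i=1}^{2n}g(Qe_i,e_i)$ for any local orthonormal basis $(e_i)$ of $\mathcal D$; equivalently $\mathrm{trace}\,Q=2n+\mathrm{trace}\,\tilde Q$, where $\tilde Q=Q-\mathrm{id}_{TM}$. *)

(* Defs.v *)
From HB Require Import structures.
From mathcomp Require Import all_boot all_order all_algebra.
From mathcomp Require Import all_classical all_reals all_analysis.

Set Implicit Arguments.
Unset Strict Implicit.
Unset Printing Implicit Defensive.

Import Order.TTheory GRing.Theory Num.Theory.
Import numFieldNormedType.Exports.

Local Open Scope classical_set_scope.
Local Open Scope ring_scope.

(** * Smooth maps between normed spaces *)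

(* [Ck_on k U f] and [smooth_on U f] are meant for an open set [U] of a
   finite-dimensional space; the values of [f] outside [U] are irrelevant. *)
Fixpoint Ck_on (R : realType) (V W : normedModType R) (k : nat)
    (U : set V) (f : V -> W) : Prop :=
  match k with
  | 0 => forall x, U x -> {for x, continuous f}
  | k'.+1 => (forall x, U x -> differentiable f x) /\
             (forall v, Ck_on k' U (fun x => 'D_v f x))
  end.

Definition smooth_on (R : realType) (V W : normedModType R)
    (U : set V) (f : V -> W) : Prop := forall k, Ck_on k U f.

(** * Smooth manifolds *)

(* [param c] is the inverse of the chart [coord c : dom c -> 'rV[R]_m]. *)
Record smooth_manifold (R : realType) (m : nat) (M : topologicalType) :=
SmoothManifold {
  chart : Type;
  dom : chart -> set M;
  coord : chart -> M -> 'rV[R]_m;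
  param : chart -> 'rV[R]_m -> M;
  mfd_hausdorff : hausdorff_space M;
  mfd_second_countable : @second_countable M;
  dom_open : forall c, open (dom c);
  dom_cover : forall p, exists c, dom c p;
  range_open : forall c, open (coord c @` dom c);
  coordK : forall c p, dom c p -> param c (coord c p) = p;
  coord_cont : forall c p, dom c p -> {for p, continuous (coord c)};
  param_cont : forall c x, (coord c @` dom c) x ->
    {for x, continuous (param c)};
  transition_smooth : forall c d,
    smooth_on (coord c @` (dom c `&` dom d)) (coord d \o param c)
}.

Definition chart_range (R : realType) (m : nat) (M : topologicalType)
    (A : smooth_manifold R m M) (c : chart A) : set 'rV[R]_m :=
  coord c @` dom c.

(** * Tensor fields *)

(* A tensor field is given by its smooth components in each chart.  [law J t t']
   says how components [t] at a point in the old coordinates and [t'] in the new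
   coordinates are related, [J] being the Jacobian matrix of the change of
   coordinates; tangent vectors are row vectors and change by [u' = u *m J]. *)
Record tensor_field (R : realType) (m : nat) (M : topologicalType)
    (A : smooth_manifold R m M) (T : normedModType R)
    (law : 'M[R]_m -> T -> T -> Prop) := TensorField {
  comp :> chart A -> 'rV[R]_m -> T;
  comp_smooth : forall c, smooth_on (chart_range c) (comp c);
  comp_law : forall c d p, dom c p -> dom d p ->
    law (jacobian (coord d \o param c) (coord c p))
        (comp c (coord c p)) (comp d (coord d p))
}.

Definition vector_field (R : realType) (m : nat) (M : topologicalType)
    (A : smooth_manifold R m M) :=
  @tensor_field R m M A 'rV[R]_m (fun J u u' => u' = u *m J).

Definition one_form (R : realType) (m : nat) (M : topologicalType)
    (A : smooth_manifold R m M) :=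
  @tensor_field R m M A 'cV[R]_m (fun J a a' => a = J *m a').

(* (1,1)-tensor fields; an endomorphism [F] sends [u] to [u *m F]. *)
Definition endo_field (R : realType) (m : nat) (M : topologicalType)
    (A : smooth_manifold R m M) :=
  @tensor_field R m M A 'M[R]_m (fun J F F' => F *m J = J *m F').

Definition bilinear_law (R : realType) (m : nat) (J b b' : 'M[R]_m) : Prop :=
  b = J *m b' *m J^T.

Definition pair1 (R : realType) (m : nat) (a : 'cV[R]_m) (u : 'rV[R]_m) : R :=
  (u *m a) 0 0.

Definition pair2 (R : realType) (m : nat) (b : 'M[R]_m) (u v : 'rV[R]_m) : R :=
  (u *m b *m v^T) 0 0.

Record riemannian_metric (R : realType) (m : nat) (M : topologicalType)
    (A : smooth_manifold R m M) := RiemannianMetric {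
  metric :> @tensor_field R m M A 'M[R]_m (@bilinear_law R m);
  metric_sym : forall c x, chart_range c x -> forall u v,
    pair2 (metric c x) u v = pair2 (metric c x) v u;
  metric_pos : forall c x, chart_range c x -> forall u,
    u != 0 -> 0 < pair2 (metric c x) u u
}.

(** * Differential calculus in a chart *)

(* The vector fields below are smooth maps [X : 'rV[R]_m -> 'rV[R]_m] on the
   range of a chart, i.e. vector fields on its coordinate domain. *)

Definition vf_deriv (R : realType) (m : nat) (X : 'rV[R]_m -> 'rV[R]_m)
    (f : 'rV[R]_m -> R) (x : 'rV[R]_m) : R := 'D_(X x) (f : _ -> R^o) x.

Definition lie_bracket (R : realType) (m : nat)
    (X Y : 'rV[R]_m -> 'rV[R]_m) (x : 'rV[R]_m) : 'rV[R]_m :=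
  'D_(X x) Y x - 'D_(Y x) X x.

(* The k-th coordinate of [G x i j] is the Christoffel symbol Gamma^k_ij at x. *)
Definition connection_coef (R : realType) (m : nat) :=
  'rV[R]_m -> 'I_m -> 'I_m -> 'rV[R]_m.

Definition nabla (R : realType) (m : nat) (G : connection_coef R m)
    (X Y : 'rV[R]_m -> 'rV[R]_m) (x : 'rV[R]_m) : 'rV[R]_m :=
  'D_(X x) Y x + \sum_i \sum_j (X x 0 i * Y x 0 j) *: G x i j.

(* The transformation law of [G] under changes of charts is not required: it
   follows from the uniqueness of the Levi-Civita connection in each chart. *)
Definition levi_civita (R : realType) (m : nat) (M : topologicalType)
    (A : smooth_manifold R m M) (g : riemannian_metric A)
    (G : chart A -> connection_coef R m) : Prop :=
  forall c : chart A,
  (forall i j, smooth_on (chart_range c) (fun x => G c x i j)) /\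
  (forall X Y Z : 'rV[R]_m -> 'rV[R]_m,
    smooth_on (chart_range c) X -> smooth_on (chart_range c) Y ->
    smooth_on (chart_range c) Z ->
    forall x, chart_range c x ->
      nabla (G c) X Y x - nabla (G c) Y X x = lie_bracket X Y x /\
      vf_deriv X (fun y => pair2 (g c y) (Y y) (Z y)) x =
        pair2 (g c x) (nabla (G c) X Y x) (Z x) +
        pair2 (g c x) (Y x) (nabla (G c) X Z x)).

(* R(X,Y)Z = nabla_X nabla_Y Z - nabla_Y nabla_X Z - nabla_[X,Y] Z *)
Definition curvature (R : realType) (m : nat) (G : connection_coef R m)
    (X Y Z : 'rV[R]_m -> 'rV[R]_m) (x : 'rV[R]_m) : 'rV[R]_m :=
  nabla G X (nabla G Y Z) x - nabla G Y (nabla G X Z) x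
  - nabla G (lie_bracket X Y) Z x.

(* Ric(Y,Z) is the trace of W |-> R(W,Y)Z.  The curvature being a tensor,
   its value on tangent vectors is computed on their constant extensions. *)
Definition ricci (R : realType) (m : nat) (G : connection_coef R m)
    (x : 'rV[R]_m) : 'M[R]_m :=
  \matrix_(i, j) \tr (lin1_mx (fun w =>
    curvature G (cst w) (cst (delta_mx 0 i)) (cst (delta_mx 0 j)) x)).

(* (nabla_X Ric)(Y,Z) *)
Definition nabla_ricci (R : realType) (m : nat) (G : connection_coef R m)
    (X Y Z : 'rV[R]_m -> 'rV[R]_m) (x : 'rV[R]_m) : R :=
  vf_deriv X (fun y => pair2 (ricci G y) (Y y) (Z y)) x
  - pair2 (ricci G x) (nabla G X Y x) (Z x)
  - pair2 (ricci G x) (Y x) (nabla G X Z x).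

(* trace of Ric with respect to g, i.e. g^ij Ric_ij *)
Definition scalar_curvature (R : realType) (m : nat) (G : connection_coef R m)
    (b : 'rV[R]_m -> 'M[R]_m) (x : 'rV[R]_m) : R :=
  \tr (invmx (b x) *m ricci G x).

Definition einstein (R : realType) (m : nat) (M : topologicalType)
    (A : smooth_manifold R m M) (g : riemannian_metric A)
    (G : chart A -> connection_coef R m) : Prop :=
  exists lambda : R, forall (c : chart A) x, chart_range c x ->
    ricci (G c) x = lambda *: g c x.

Definition ext_deriv (R : realType) (m : nat) (a : 'rV[R]_m -> 'cV[R]_m)
    (X Y : 'rV[R]_m -> 'rV[R]_m) (x : 'rV[R]_m) : R :=
  2^-1 * (vf_deriv X (fun y => pair1 (a y) (Y y)) x
          - vf_deriv Y (fun y => pair1 (a y) (X y)) x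
          - pair1 (a x) (lie_bracket X Y x)).

(* (L_V b)(X,Y) for a covariant 2-tensor field b *)
Definition lie_deriv2 (R : realType) (m : nat) (V : 'rV[R]_m -> 'rV[R]_m)
    (b : 'rV[R]_m -> 'M[R]_m) (X Y : 'rV[R]_m -> 'rV[R]_m) (x : 'rV[R]_m) : R :=
  vf_deriv V (fun y => pair2 (b y) (X y) (Y y)) x
  - pair2 (b x) (lie_bracket V X x) (Y x)
  - pair2 (b x) (X x) (lie_bracket V Y x).

(** * Weak contact structures *)

Record weak_almost_contact (R : realType) (m : nat) (M : topologicalType)
    (A : smooth_manifold R m M) (phi Q : endo_field A)
    (xi : vector_field A) (eta : one_form A) : Prop := WeakAlmostContact {
  Q_nonsingular : forall c x, chart_range c x -> Q c x \in unitmx;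
  eta_xi : forall c x, chart_range c x -> pair1 (eta c x) (xi c x) = 1;
  phi_sq : forall c x, chart_range c x -> forall u : 'rV[R]_m,
    u *m phi c x *m phi c x = - (u *m Q c x) + pair1 (eta c x) u *: xi c x;
  Q_xi : forall c x, chart_range c x -> xi c x *m Q c x = xi c x;
  phi_ker_eta : forall c x, chart_range c x -> forall u : 'rV[R]_m,
    pair1 (eta c x) u = 0 -> pair1 (eta c x) (u *m phi c x) = 0
}.

Record weak_almost_contact_metric (R : realType) (m : nat)
    (M : topologicalType) (A : smooth_manifold R m M) (phi Q : endo_field A)
    (xi : vector_field A) (eta : one_form A) (g : riemannian_metric A) : Prop :=
WeakAlmostContactMetric {
  wacm_wac :> weak_almost_contact phi Q xi eta;
  metric_compat : forall c x, chart_range c x -> forall u v : 'rV[R]_m,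
    pair2 (g c x) (u *m phi c x) (v *m phi c x) =
    pair2 (g c x) u (v *m Q c x) - pair1 (eta c x) u * pair1 (eta c x) v
}.

Record weak_contact_metric (R : realType) (m : nat)
    (M : topologicalType) (A : smooth_manifold R m M) (phi Q : endo_field A)
    (xi : vector_field A) (eta : one_form A) (g : riemannian_metric A) : Prop :=
WeakContactMetric {
  wcm_wacm :> weak_almost_contact_metric phi Q xi eta g;
  contact_form : forall (c : chart A) (X Y : 'rV[R]_m -> 'rV[R]_m),
    smooth_on (chart_range c) X -> smooth_on (chart_range c) Y ->
    forall x, chart_range c x ->
      pair2 (g c x) (X x) (Y x *m phi c x) = ext_deriv (eta c) X Y x
}.

Definition killing (R : realType) (m : nat) (M : topologicalType)
    (A : smooth_manifold R m M) (g : riemannian_metric A)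
    (V : vector_field A) : Prop :=
  forall (c : chart A) (X Y : 'rV[R]_m -> 'rV[R]_m),
    smooth_on (chart_range c) X -> smooth_on (chart_range c) Y ->
    forall x, chart_range c x -> lie_deriv2 (V c) (g c) X Y x = 0.

Record weak_K_contact (R : realType) (m : nat)
    (M : topologicalType) (A : smooth_manifold R m M) (phi Q : endo_field A)
    (xi : vector_field A) (eta : one_form A) (g : riemannian_metric A) : Prop :=
WeakKContact {
  wKc_wcm :> weak_contact_metric phi Q xi eta g;
  reeb_killing : killing g xi
}.

(* [t] is the trace over ker a of the endomorphism [F]: the sum of b(F e_i, e_i)
   over any b-orthonormal basis (e_i) of the hyperplane ker a. *)
Definition is_trace_on_ker (R : realType) (m : nat) (b F : 'M[R]_m.+1)
    (a : 'cV[R]_m.+1) (t : R) : Prop :=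
  forall e : 'I_m -> 'rV[R]_m.+1,
    (forall i, pair1 a (e i) = 0) ->
    (forall i j, pair2 b (e i) (e j) = (i == j)%:R) ->
    \sum_i pair2 b (e i *m F) (e i) = t.

(* Main.v *)
Require Import Defs.
From mathcomp Require Import all_boot all_order all_algebra.
From mathcomp Require Import all_classical all_reals all_analysis.
From mathcomp Require Import ring lra.

(* The Killing and contact conditions give [nabla_X xi = - phi X].  The Ricci
   identity for [xi] then reads
   [R(W, X) xi = (nabla_X phi) W - (nabla_W phi) X]; as [phi] is skew-symmetric
   and kills [xi], tracing over [W] yields [Ric(xi, xi) = - tr (phi^2)], which
   is the trace of [Q] over [ker eta].  This being constant,
   [(nabla_X Ric)(xi, xi) = 0] says [Ric(phi X, xi) = 0], that is
   [Ric(xi, .) = (trace Q) eta]; inserting this in [(nabla_X Ric)(xi, Y) = 0]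
   gives [Ric(phi X, Y) = (trace Q) g(phi X, Y)], and [phi] is onto [ker eta].
   All computations are made in one chart, on constant vector fields. *)

Set Implicit Arguments.
Unset Strict Implicit.
Unset Printing Implicit Defensive.

Import Order.TTheory GRing.Theory Num.Theory.
Import numFieldNormedType.Exports.

Local Open Scope ring_scope.

(** * Directional derivatives: product rules and symmetry of second derivatives *)

Section Directional.
Local Open Scope classical_set_scope.
Context {R : realType} {V : normedModType R}.

Lemma is_derive_mxP (p q : nat) (f : V -> 'M[R]_(p, q)) x v df :
  is_derive x v f df <->
  forall i j, is_derive x v (fun y => f y i j) (df i j).
Proof.
split=> [[f1 <-] i j|fij].
  have f2 := (derivable_mxP f x v).1 f1.
  by apply: DeriveDef; rewrite // derive_mx// mxE.
have f1 : derivable f x v by apply/derivable_mxP => i j; case: (fij i j).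
apply: DeriveDef => //; rewrite derive_mx//.
by apply/matrixP => i j; rewrite mxE; case: (fij i j).
Qed.

Lemma is_derive_mulmx (p q r : nat) (f : V -> 'M[R]_(p, q))
    (h : V -> 'M[R]_(q, r)) x v df dh :
  is_derive x v f df -> is_derive x v h dh ->
  is_derive x v (fun y => f y *m h y) (df *m h x + f x *m dh).
Proof.
move=> /is_derive_mxP df1 /is_derive_mxP dh1; apply/is_derive_mxP => i k.
rewrite [X in is_derive _ _ X _](_ : _ =
    \sum_j ((fun y => f y i j) * (fun y => h y j k))); last first.
  by apply/funext => y; rewrite mxE fct_sumE.
rewrite !mxE -big_split/=; apply: is_derive_sum => j.
by rewrite addrC [df i j * _]mulrC; exact: is_deriveM (df1 i j) (dh1 j k).
Qed.

Lemma is_derive_trmx (p q : nat) (f : V -> 'M[R]_(p, q)) x v df :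
  is_derive x v f df -> is_derive x v (fun y => (f y)^T) df^T.
Proof.
move=> /is_derive_mxP df1; apply/is_derive_mxP => i j.
by rewrite mxE; under eq_fun do rewrite mxE; exact: df1.
Qed.

Lemma is_derive_mxtrace (p : nat) (f : V -> 'M[R]_p) x v df :
  is_derive x v f df -> is_derive x v (fun y => \tr (f y)) (\tr df).
Proof.
move=> /is_derive_mxP df1.
rewrite [X in is_derive _ _ X _](_ : _ = \sum_j (fun y => f y j j)).
  by apply: is_derive_sum => j; exact: df1.
by apply/funext => y; rewrite fct_sumE.
Qed.

Lemma derive_open (W : normedModType R) (U : set V) (f h : V -> W) x v :
  open U -> U x -> (forall y, U y -> f y = h y) -> 'D_v f x = 'D_v h x.
Proof.
move=> Uo Ux fh; apply: near_eq_derive.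
by apply: filterS (open_nbhs_nbhs (conj Uo Ux)).
Qed.

(** Restriction to a line, which brings directional derivatives within reach of the one-variable
    mean value theorem. *)
Lemma is_derive_line (W : normedModType R) (f : V -> W) (x v : V) (s : R) df :
  is_derive (x + s *: v) v f df ->
  is_derive s 1 (fun t : R => f (x + t *: v)) df.
Proof.
have E : (fun h : R => h^-1 *:
      (((fun t : R => f (x + t *: v)) \o shift s) (h *: 1) - f (x + s *: v))) =
    (fun h : R => h^-1 *: ((f \o shift (x + s *: v)) (h *: v) - f (x + s *: v))).
  apply/funext => h /=; congr (_ *: (f _ - _)).
  by rewrite scalerDl [h *: 1]mulr1 addrCA.
by case=> f1 f2; apply: DeriveDef; [rewrite /derivable E|rewrite /derive E].
Qed.

Lemma MVT0 (f df : R -> R) (h : R) : 0 < h ->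
  (forall s, s \in `[0, h]%R -> is_derive s 1 f (df s)) ->
  exists2 c, c \in `]0, h[%R & f h - f 0 = h * df c.
Proof.
move=> h0 fdf.
have fc : {within `[0, h], continuous f}.
  by apply: derivable_within_continuous => s sh; have [] := fdf s sh.
have fd s : s \in `]0, h[%R -> is_derive s 1 f (df s).
  by move=> sh; apply: fdf; apply: subset_itv_oo_cc sh.
have [c ch E] := MVT h0 fd fc.
by exists c => //; rewrite E subr0 mulrC.
Qed.

(* Two applications of the mean value theorem to the second difference
   quotient, which is symmetric in [u] and [v]. *)
Lemma second_difference (f : V -> R) (x u v : V) (h : R) : 0 < h ->
  (forall s t, s \in `[0, h]%R -> t \in `[0, h]%R ->
    derivable f (x + s *: u + t *: v) u /\
    derivable ('D_u f) (x + s *: u + t *: v) v) ->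
  exists s t, [/\ s \in `]0, h[%R, t \in `]0, h[%R &
    f (x + h *: u + h *: v) - f (x + h *: u) - f (x + h *: v) + f x =
    h * (h * 'D_v ('D_u f) (x + s *: u + t *: v))].
Proof.
move=> h0 fd.
have h00 : (0 : R) \in `[0, h]%R by rewrite in_itv/= lexx ltW.
have hh : h \in `[0, h]%R by rewrite in_itv/= lexx ltW.
pose p (s : R) := f (x + h *: v + s *: u) - f (x + s *: u).
pose dp (s : R) := 'D_u f (x + h *: v + s *: u) - 'D_u f (x + s *: u).
have [|s sh Es] := @MVT0 p dp h h0.
  move=> s sh.
  have [+ _] := fd s h sh hh; rewrite addrAC => /derivableP/is_derive_line d1.
  have [+ _] := fd s 0 sh h00.
  rewrite scale0r addr0 => /derivableP/is_derive_line d2.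
  exact: is_deriveB.
have sh' : s \in `[0, h]%R by exact: subset_itv_oo_cc sh.
pose q (t : R) := 'D_u f (x + s *: u + t *: v).
have [|t th Et] := @MVT0 q (fun t => 'D_v ('D_u f) (x + s *: u + t *: v)) h h0.
  by move=> t th; have [_ /derivableP/is_derive_line] := fd s t sh' th.
exists s, t; split=> //; rewrite -Et /q scale0r addr0.
rewrite [x + s *: u + _]addrAC -/(dp s) -Es /p scale0r !addr0.
by rewrite [x + h *: v + _]addrAC opprB !addrA addrAC -!addrA;
  congr (_ + _); ring.
Qed.

(** Schwarz's theorem: both mixed derivatives, taken at suitable points near [x], equal the same
    second difference quotient, and continuity at [x] makes their values at [x] differ by less than
    any [e]. *)
Lemma derive_swap_real (f : V -> R) (x u v : V) :
  (\forall y \near x, [/\ derivable f y u, derivable f y v,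
     derivable ('D_u f) y v & derivable ('D_v f) y u]) ->
  {for x, continuous ('D_v ('D_u f))} -> {for x, continuous ('D_u ('D_v f))} ->
  'D_v ('D_u f) x = 'D_u ('D_v f) x.
Proof.
move=> fd cvu cuv; apply/eqP; rewrite -subr_eq0 -normr_le0.
apply/ler_addgt0Pr => e e0; rewrite add0r.
have e20 : 0 < e / 2 by rewrite divr_gt0.
move/cvgrPdist_lt : cvu => /(_ _ e20) nvu.
move/cvgrPdist_lt : cuv => /(_ _ e20) nuv.
have NB : \forall y \near x,
    (`|'D_v ('D_u f) x - 'D_v ('D_u f) y| < e / 2 /\
     `|'D_u ('D_v f) x - 'D_u ('D_v f) y| < e / 2) /\
    [/\ derivable f y u, derivable f y v,
     derivable ('D_u f) y v & derivable ('D_v f) y u].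
  exact: filterI (filterI nvu nuv) fd.
move/nbhs_ballP : NB => [r /= r0 rB].
(* The parallelogram spanned at [x] by [h *: u] and [h *: v] must stay in the ball of radius [r]:
   its points are within [r / 2] of [x]. The summand 1 keeps the denominator positive when [u] and
   [v] vanish. *)
pose h := r / (1 + `|u| + `|v|) / 2.
have N0 : 0 < 1 + `|u| + `|v| by rewrite -addrA ltr_wpDr// addr_ge0.
have h0 : 0 < h by rewrite !divr_gt0.
have inB s t : s \in `[0, h]%R -> t \in `[0, h]%R ->
    ball x r (x + s *: u + t *: v).
  rewrite !in_itv/= => /andP[s0 sh] /andP[t0 th].
  rewrite -ball_normE/= -addrA opprD addNKr normrN.
  rewrite (le_lt_trans (ler_normD _ _))// !normrZ !ger0_norm//.
  apply: (@le_lt_trans _ _ (h * (1 + `|u| + `|v|))).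
    rewrite !mulrDr -addrA ler_wpDl//; first by rewrite mulr1 ltW.
    by rewrite lerD// ler_wpM2r.
  rewrite /h mulrAC divfK ?gt_eqF// ltr_pdivrMr// mulr_natr mulr2n.
  by rewrite ltrDl.
have [|s [t [sh th E1]]] := @second_difference f x u v h h0.
  by move=> s t sh th; have [_ []] := rB _ (inB s t sh th).
have [|s' [t' [sh' th' E2]]] := @second_difference f x v u h h0.
  move=> s' t' sh' th'; rewrite (addrAC x (s' *: v)).
  have [_ [_ d1 _ d2]] := rB _ (inB t' s' th' sh').
  exact: conj d1 d2.
(* Multiplied by [h] twice, both sides are the same second difference. *)
have E : 'D_v ('D_u f) (x + s *: u + t *: v) =
         'D_u ('D_v f) (x + s' *: v + t' *: u).
  apply: (mulfI (lt0r_neq0 h0)); apply: (mulfI (lt0r_neq0 h0)).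
  apply: etrans (esym E1) (etrans _ E2); rewrite (addrAC x (h *: v)).
  by rewrite (addrAC (f (x + h *: u + h *: v)) (- f (x + h *: u))).
have [[/= B1 _] _] := rB _ (inB s t (subset_itv_oo_cc sh) (subset_itv_oo_cc th)).
have [[/= _ B2] _] := rB _ (inB t' s' (subset_itv_oo_cc th') (subset_itv_oo_cc sh')).
rewrite addrAC -E in B2.
rewrite -(subrKA ('D_v ('D_u f) (x + s *: u + t *: v))).
apply: le_trans (ler_normD _ _) _; rewrite [leRHS]splitr.
by apply: lerD; [exact: ltW B1|rewrite distrC; exact: ltW B2].
Qed.

Lemma derive_entry (p q : nat) (f : V -> 'M[R]_(p, q)) x v i j :
  derivable f x v -> 'D_v (fun y => f y i j) x = ('D_v f x) i j.
Proof. by move=> fx; rewrite derive_mx// mxE. Qed.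

(** The real case applied to each entry. Entries of derivatives are identified with derivatives of
    entries on the open set [U], hence near each of its points, which transports derivability and
    continuity. *)
Lemma derive_swap (p q : nat) (U : set V) (f : V -> 'M[R]_(p, q)) (x u v : V) :
  open U -> U x -> smooth_on U f -> 'D_v ('D_u f) x = 'D_u ('D_v f) x.
Proof.
move=> Uo Ux /(_ 2%N)[fd fd2].
have d1 y w : U y -> derivable f y w by move=> /fd; exact: diff_derivable.
have d2 y w z : U y -> derivable ('D_w f) y z.
  by move=> Uy; apply: diff_derivable; apply: (fd2 w).1.
have nU : nbhs x U by exact: open_nbhs_nbhs.
have E w i j : forall y, U y -> ('D_w f y) i j = 'D_w (fun y => f y i j) y.
  by move=> y Uy; rewrite derive_entry//; exact: d1.
have E2 w z i j y : U y ->
    ('D_z ('D_w f) y) i j = 'D_z ('D_w (fun y => f y i j)) y.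
  move=> Uy; rewrite -derive_entry; last exact: d2.
  by apply: (@derive_open _ U) => // y' Uy'; rewrite E.
have ct w z i j : {for x, continuous ('D_z ('D_w (fun y => f y i j)))}.
  have c2 := (fd2 w).2 z _ Ux.
  have c3 : ('D_z ('D_w f) y) i j @[y --> x] --> ('D_z ('D_w f) x) i j.
    exact: (@continuous_comp _ _ _ _ (fun M : 'M[R]_(p, q) => M i j) x c2
      (@coord_continuous _ _ _ i j _)).
  have c4 : 'D_z ('D_w (fun y => f y i j)) y @[y --> x] --> ('D_z ('D_w f) x) i j.
    apply: cvg_trans c3; apply: near_eq_cvg.
    by apply: filterS nU => y Uy; exact: E2.
  exact: eq_rect _ (fun l => _ @ x --> l) c4 _ (E2 w z i j x Ux).
apply/matrixP => i j.
apply: etrans (E2 _ _ _ _ _ Ux) (etrans _ (esym (E2 _ _ _ _ _ Ux))).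
apply: derive_swap_real; [|exact: ct|exact: ct].
apply: filterS nU => y Uy.
have e1 w : derivable (fun y => f y i j) y w.
  by have /derivable_mxP := d1 y w Uy; apply.
have e2 w z : derivable ('D_w (fun y => f y i j)) y z.
  have /derivable_mxP/(_ i j) := d2 y w z Uy.
  apply: near_eq_derivable.
  by apply: filterS (open_nbhs_nbhs (conj Uo Uy)) => y' Uy'; exact: E.
by split; [exact: e1|exact: e1|exact: e2|exact: e2].
Qed.

Lemma smooth_on_cst (W : normedModType R) (U : set V) (w : W) :
  smooth_on U (cst w).
Proof.
move=> k; elim: k w => [|k IH] w /=; first by move=> x _; exact: cvg_cst.
split=> [x _|v]; first exact: differentiable_cst.
rewrite (_ : (fun _ => _) = cst 0); first exact: IH.
by apply/funext => x; rewrite derive_cst.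
Qed.

Lemma smooth_on_is_derive (W : normedModType R) (U : set V) (f : V -> W) x v :
  smooth_on U f -> U x -> is_derive x v f ('D_v f x).
Proof.
by move=> /(_ 1%N)[fd _] Ux; apply/derivableP/diff_derivable/fd.
Qed.

End Directional.

(** * Linear algebra: skew endomorphisms, orthonormal bases and traces *)

Section LinearAlgebra.
Context {R : realType}.

Lemma row_mul_inj (p q : nat) (A B : 'M[R]_(p, q)) :
  (forall u : 'rV_p, u *m A = u *m B) -> A = B.
Proof. by move=> AB; apply/row_matrixP => i; rewrite !rowE AB. Qed.

Lemma pair2_inj (p : nat) (A B : 'M[R]_p) :
  (forall u v, pair2 A u v = pair2 B u v) -> A = B.
Proof.
move=> AB; apply/matrixP => i j; have := AB (delta_mx 0 i) (delta_mx 0 j).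
by rewrite /pair2 !trmx_delta -!rowE -!colE !mxE.
Qed.

Lemma pair2_row_inj (p : nat) (u w : 'rV[R]_p) :
  (forall v : 'rV_p, (u *m v^T) 0 0 = (w *m v^T) 0 0) -> u = w.
Proof.
move=> uw; apply/rowP => j; have := uw (delta_mx 0 j).
by rewrite trmx_delta -!colE !mxE.
Qed.

Lemma mulmx_trC (p : nat) (u v : 'rV[R]_p) :
  (u *m v^T) 0 0 = (v *m u^T) 0 0.
Proof. by rewrite -[u *m _]trmxK trmx_mul trmxK mxE. Qed.

Lemma pair2Dl (p : nat) (b : 'M[R]_p) u v w :
  pair2 b (u + v) w = pair2 b u w + pair2 b v w.
Proof. by rewrite /pair2 !mulmxDl mxE. Qed.

Lemma pair2Dr (p : nat) (b : 'M[R]_p) u v w :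
  pair2 b w (u + v) = pair2 b w u + pair2 b w v.
Proof. by rewrite /pair2 linearD/= mulmxDr mxE. Qed.

Lemma pair2Nl (p : nat) (b : 'M[R]_p) u v : pair2 b (- u) v = - pair2 b u v.
Proof. by rewrite /pair2 !mulNmx mxE. Qed.

Lemma pair2Nr (p : nat) (b : 'M[R]_p) u v : pair2 b u (- v) = - pair2 b u v.
Proof. by rewrite /pair2 linearN/= mulmxN mxE. Qed.

Lemma pair2C (p : nat) (b : 'M[R]_p) u v : b^T = b -> pair2 b u v = pair2 b v u.
Proof. by move=> bT; rewrite /pair2 mulmx_trC trmx_mul bT mulmxA. Qed.

Lemma mx11E (A : 'M[R]_1) (a : R) : (A == a%:M) = (A 0 0 == a).
Proof.
rewrite [A]mx11_scalar mxE eqxx mulr1n; apply/eqP/eqP => [|->//].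
by move/matrixP/(_ 0 0); rewrite !mxE eqxx !mulr1n.
Qed.

Lemma mxtrace_delta (p : nat) (A : 'M[R]_p) :
  \tr A = \sum_k (delta_mx 0 k *m A : 'rV_p) 0 k.
Proof. by apply: eq_bigr => k _; rewrite -rowE mxE. Qed.

(** The hypothesis says that [K] is skew for the form [g]. Then [K] is conjugate to the opposite of
    its transpose, so its trace is its own opposite. *)
Lemma mxtrace_skew (p : nat) (g K : 'M[R]_p) :
  g \in unitmx -> K *m g = - (g *m K^T) -> \tr K = 0.
Proof.
move=> gu Kg; have : \tr K = - \tr K.
  rewrite -[in LHS](mulmxK gu K) Kg mulNmx raddfN/= mxtrace_mulC mulKmx//.
  by rewrite mxtrace_tr.
by move=> E; apply/eqP; rewrite -[_ == 0](mulrn_eq0 _ 2) mulr2n {1}E addNr.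
Qed.

Section Gram.
Context (p : nat) (g : 'M[R]_p).
Hypothesis g_pos : forall u, u != 0 -> 0 < pair2 g u u.

Lemma posdef_unitmx : g \in unitmx.
Proof.
rewrite -row_free_unit -kermx_eq0; apply/eqP/row_matrixP => i.
rewrite row0; apply/eqP; apply: contraT => /g_pos.
by rewrite /pair2 -row_mul mulmx_ker row0 mul0mx mxE ltxx.
Qed.

(** The matrix [g *m E^T] has fewer columns than rows, so its left kernel contains a nonzero vector,
    which is then normalised. *)
Lemma orthonormal_extend (k : nat) (E : 'M[R]_(k, p)) : (k < p)%N ->
  exists u : 'rV[R]_p, u *m g *m E^T = 0 /\ u *m g *m u^T = 1%:M.
Proof.
move=> kp; have : kermx (g *m E^T) != 0.
  rewrite kermx_eq0 -row_leq_rank -ltnNge.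
  by rewrite (leq_ltn_trans (rank_leq_col _) kp).
case/rowV0Pn => w /sub_kermxP wE w0; have wg := g_pos w0.
pose s := Num.sqrt (pair2 g w w).
have s0 : s != 0 by rewrite gt_eqF// sqrtr_gt0.
exists (s^-1 *: w); rewrite -!scalemxAl -mulmxA wE scaler0; split=> //.
rewrite linearZ/= -scalemxAr scalerA; apply/eqP.
rewrite mx11E mxE -/(pair2 g w w) -[X in _ * X]sqr_sqrtr ?ltW// -/s.
by rewrite expr2 mulrACA mulVf// mul1r.
Qed.

Hypothesis g_sym : g^T = g.

Lemma orthonormal_completion (x : 'rV[R]_p) (k : nat) : (k < p)%N ->
  x *m g *m x^T = 1%:M ->
  exists E : 'M[R]_(k, p), x *m g *m E^T = 0 /\ E *m g *m E^T = 1%:M.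
Proof.
move=> + x1; elim: k => [_|k IH kp].
  by exists 0; rewrite trmx0 !mulmx0 [1%:M]flatmx0.
have [E [xE EE]] := IH (ltnW kp).
(* The new vector is taken orthogonal to [x] as well as to [E]: together they have [1 + k] rows,
   still fewer than [p]. *)
have [u [uB uu]] := @orthonormal_extend (1 + k)%N (col_mx x E) kp.
rewrite tr_col_mx mul_mx_row -row_mx0 in uB.
have [ux uE] := eq_row_mx uB.
have T q r (A : 'M[R]_(q, p)) (B : 'M[R]_(r, p)) : A *m g *m B^T = (B *m g *m A^T)^T.
  by rewrite !trmx_mul trmxK g_sym mulmxA.
have xB : x *m g *m (col_mx u E)^T = 0.
  by rewrite tr_col_mx mul_mx_row T ux xE trmx0 row_mx0.
have BB : col_mx u E *m g *m (col_mx u E)^T = 1%:M.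
  rewrite tr_col_mx !mul_col_mx !mul_mx_row uu uE EE [E *m g *m u^T]T uE trmx0.
  by rewrite -block_mxEv -scalar_mx_block.
by exists (col_mx u E : 'M[R]_(1 + k, p)); split; [exact: xB|exact: BB].
Qed.

End Gram.

(** Completing the unit vector [x] by an orthonormal basis [E] of the kernel of [a], the trace of
    [Q] splits into the contribution of [x], which is 1 as [Q] fixes [x], and that of [E], which is
    [t]. The existence of [E] is what gives access to [t]. *)
Lemma trace_on_ker (m : nat) (g Q : 'M[R]_m.+1) (a : 'cV[R]_m.+1)
    (x : 'rV[R]_m.+1) (t : R) :
  (forall u, u != 0 -> 0 < pair2 g u u) -> g^T = g ->
  a = g *m x^T -> x *m a = 1%:M -> x *m Q = x ->
  is_trace_on_ker g Q a t -> \tr Q = 1 + t.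
Proof.
move=> gpos gsym aE xa xQ trQ.
have xx : x *m g *m x^T = 1%:M by rewrite -mulmxA -aE.
have [E [xE EE]] := orthonormal_completion gpos gsym (ltnSn m) xx.
have Ex : E *m g *m x^T = 0.
  have <- : (x *m g *m E^T)^T = E *m g *m x^T.
    by rewrite !trmx_mul trmxK gsym mulmxA.
  by rewrite xE trmx0.
have -> : t = \tr (E *m Q *m g *m E^T).
  rewrite -(trQ (fun i => row i E)).
  - apply: eq_bigr => i _; rewrite /pair2 -!row_mul !mxE.
    by apply: eq_bigr => j _; rewrite !mxE.
  - by move=> i; rewrite /pair1 aE -row_mul mulmxA Ex row0 mxE.
  move=> i j; move/matrixP/(_ i j): EE; rewrite /pair2 !mxE => <-.
  by apply: eq_bigr => l _; rewrite -!row_mul !mxE.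
pose B : 'M[R]_(1 + m, m.+1) := col_mx x E.
have BB : B *m (g *m B^T) = 1%:M.
  rewrite mulmxA /B tr_col_mx !mul_col_mx !mul_mx_row xx xE Ex EE.
  by rewrite -block_mxEv -scalar_mx_block.
(* As [B] is square, orthonormality of its rows is also a resolution of the identity, which is
   inserted next to [Q] under the trace. *)
have BB' : (g *m B^T) *m B = 1%:M by apply: mulmx1C.
rewrite -[Q in LHS]mulmx1 -BB' mulmxA mxtrace_mulC !mulmxA.
rewrite /B tr_col_mx !mul_col_mx !mul_mx_row xQ xx.
rewrite -block_mxEv (@mxtrace_block _ 1%N m); congr (_ + _).
by rewrite mxtrace1.
Qed.

End LinearAlgebra.

(** This rule and the next two replace [mxE] where products of matrices must stay folded, as atoms
    for [ring] and [lra]. *)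
Lemma mxaddE (R : realType) (p q : nat) (A B : 'M[R]_(p, q)) i j :
  (A + B) i j = A i j + B i j.
Proof. by rewrite mxE. Qed.

Lemma mxoppE (R : realType) (p q : nat) (A : 'M[R]_(p, q)) i j :
  (- A) i j = - A i j.
Proof. by rewrite mxE. Qed.

Lemma mxscaleE (R : realType) (p q : nat) (a : R) (A : 'M[R]_(p, q)) i j :
  (a *: A) i j = a * A i j.
Proof. by rewrite mxE. Qed.

(* [w *m christoffel G u x] is the tangent vector Gamma(u, w) at [x]. *)
Definition christoffel (R : realType) (p : nat) (G : connection_coef R p)
    (u x : 'rV[R]_p) : 'M[R]_p :=
  \matrix_(j, k) \sum_i u 0 i * G x i j 0 k.

(* [v *m riemann G w u x] is R(w, u)v at [x]. *)
Definition riemann (R : realType) (p : nat) (G : connection_coef R p)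
    (w u x : 'rV[R]_p) : 'M[R]_p :=
  'D_w (christoffel G u) x - 'D_u (christoffel G w) x
  + christoffel G u x *m christoffel G w x
  - christoffel G w x *m christoffel G u x.

(** * Curvature and Ricci tensor of a connection in one chart *)

Section Connection.
Local Open Scope classical_set_scope.
Context {R : realType} {p : nat} (G : connection_coef R p).
Local Notation Gamma := (christoffel G).

Lemma nablaE X Y x : nabla G X Y x = 'D_(X x) Y x + Y x *m Gamma (X x) x.
Proof.
rewrite /nabla; congr (_ + _); apply/rowP => k.
rewrite !summxE mxE [RHS](_ : _ = \sum_i \sum_j Y x 0 i * (X x 0 j * G x j i 0 k)).
  rewrite exchange_big/=; apply: eq_bigr => j _; rewrite summxE.
  by apply: eq_bigr => i _; rewrite mxE mulrAC mulrC.
by apply: eq_bigr => i _; rewrite mxE mulr_sumr.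
Qed.

Lemma lie_bracket_cst (u v : 'rV[R]_p) : lie_bracket (cst u) (cst v) = cst 0.
Proof. by apply/funext => x; rewrite /lie_bracket !derive_cst subr0. Qed.

Lemma lie_bracket_cstr (X : 'rV[R]_p -> 'rV[R]_p) (v x : 'rV[R]_p) :
  lie_bracket X (cst v) x = - 'D_v X x.
Proof. by rewrite /lie_bracket derive_cst sub0r. Qed.

Lemma nabla_cst (u v : 'rV[R]_p) :
  nabla G (cst u) (cst v) = (fun y => v *m Gamma u y).
Proof. by apply/funext => y; rewrite nablaE derive_cst add0r. Qed.

Lemma riemannC (u w x : 'rV[R]_p) : riemann G w u x = - riemann G u w x.
Proof.
rewrite /riemann; move: ('D_w _ x) ('D_u _ x) => A B.
by apply/matrixP => i j; rewrite !(mxaddE, mxoppE); ring.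
Qed.

Context (U : set 'rV[R]_p).
Hypothesis G_smooth : forall i j, smooth_on U (fun x => G x i j).

Lemma is_derive_christoffel u w x : U x ->
  is_derive x w (Gamma u) ('D_w (Gamma u) x).
Proof.
move=> Ux; apply: derivableP; apply/derivable_mxP => j k.
rewrite (_ : (fun _ => _) = \sum_i (u 0 i \*: (fun y => G y i j 0 k))); last first.
  by apply/funext => y; rewrite mxE fct_sumE.
apply: derivable_sum => i; apply: derivableZ.
have [Gd _] := smooth_on_is_derive w (G_smooth i j) Ux.
by have /derivable_mxP := Gd; apply.
Qed.

Lemma derive_mul_christoffel (v u w x : 'rV[R]_p) : U x ->
  'D_w (fun y => v *m Gamma u y) x = v *m 'D_w (Gamma u) x.
Proof.
move=> Ux; have [_ ->] := is_derive_mulmx (is_derive_cst v x w)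
  (is_derive_christoffel u w Ux).
by rewrite mul0mx add0r.
Qed.

(** Constant fields commute, so the bracket term drops out. Since matrices act on row vectors from
    the right, the products in [riemann] appear in reversed order. *)
Lemma curvature_cst (w u v x : 'rV[R]_p) : U x ->
  curvature G (cst w) (cst u) (cst v) x = v *m riemann G w u x.
Proof.
move=> Ux; rewrite /curvature lie_bracket_cst !nabla_cst !nablaE/=.
rewrite !derive_mul_christoffel//.
rewrite (_ : Gamma 0 x = 0); last first.
  by apply/matrixP => j k; rewrite !mxE big1// => i _; rewrite mxE mul0r.
rewrite mulmx0 subr0 /riemann !mulmxDr !mulmxN -!mulmxA.
by rewrite opprD addrACA !addrA.
Qed.

Lemma ricciE x i j : U x -> ricci G x i j =
  \sum_k (delta_mx 0 j *m riemann G (delta_mx 0 k) (delta_mx 0 i) x : 'rV_p) 0 k.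
Proof.
move=> Ux; rewrite mxE; apply: eq_bigr => k _.
by rewrite mxE curvature_cst.
Qed.

Hypothesis torsion_free :
  forall x (u w : 'rV[R]_p), U x -> w *m Gamma u x = u *m Gamma w x.

Hypothesis U_open : open U.

(** First Bianchi identity: by torsion-freeness [v *m Gamma u] is symmetric in [u] and [v], and so
    are its derivatives; the terms of the cyclic sum then cancel in pairs. *)
Lemma bianchi (u v w x : 'rV[R]_p) : U x ->
  v *m riemann G w u x + w *m riemann G u v x + u *m riemann G v w x = 0.
Proof.
move=> Ux; pose T a b := torsion_free a b Ux.
have dT a b c : a *m 'D_c (Gamma b) x = b *m 'D_c (Gamma a) x.
  rewrite -(derive_mul_christoffel a b c Ux) -(derive_mul_christoffel b a c Ux).
  exact: (derive_open _ U_open Ux (fun y => @torsion_free y b a)).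
rewrite /riemann; move: (dT v u w) (dT w v u) (dT u w v) (T u v) (T v w) (T w u).
move: ('D_w (Gamma u) x) ('D_u (Gamma w) x) ('D_u (Gamma v) x) ('D_v (Gamma u) x).
move: ('D_v (Gamma w) x) ('D_w (Gamma v) x) (Gamma u x) (Gamma v x) (Gamma w x).
move=> Dvw Dwv Gu Gv Gw Dwu Duw Duv Dvu e1 e2 e3 e4 e5 e6.
rewrite !mulmxDr !mulmxN !mulmxA e1 e2 e3 e4 e5 e6.
apply/rowP => k; rewrite !(mxaddE, mxoppE) [RHS]mxE.
by do 6 move: ((_ *m _) 0 k) => ?; ring.
Qed.

Context (g : 'rV[R]_p -> 'M[R]_p).
Hypothesis g_smooth : smooth_on U g.
Hypothesis g_pos : forall x, U x -> forall u, u != 0 -> 0 < pair2 (g x) u u.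
Hypothesis metric_derive : forall x u, U x ->
  'D_u g x = Gamma u x *m g x + g x *m (Gamma u x)^T.

(** Second derivatives of [g] commute. Expressing both orders through [metric_derive] leaves exactly
    the skewness of the curvature. *)
Lemma riemann_skew (w u x : 'rV[R]_p) : U x ->
  riemann G w u x *m g x = - (g x *m (riemann G w u x)^T).
Proof.
move=> Ux.
have D2 a b : 'D_b ('D_a g) x =
    'D_b (Gamma a) x *m g x + Gamma a x *m (Gamma b x *m g x + g x *m (Gamma b x)^T)
    + ((Gamma b x *m g x + g x *m (Gamma b x)^T) *m (Gamma a x)^T
       + g x *m ('D_b (Gamma a) x)^T).
  rewrite (derive_open b U_open Ux (fun y => @metric_derive y a)).
  rewrite -!metric_derive//.
  have d1 := is_derive_christoffel a b Ux.
  have d2 := smooth_on_is_derive b g_smooth Ux.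
  by have [_ ->] := is_deriveD (is_derive_mulmx d1 d2)
    (is_derive_mulmx d2 (is_derive_trmx d1)).
have := derive_swap u w U_open Ux g_smooth; rewrite (D2 u w) (D2 w u) /riemann.
move: ('D_w (Gamma u) x) ('D_u (Gamma w) x) (Gamma u x) (Gamma w x) (g x).
move=> Dwu Duw Gu Gw h.
have trD (A B : 'M[R]_p) : (A + B)^T = A^T + B^T by exact: linearD.
have trN (A : 'M[R]_p) : (- A)^T = - A^T by exact: linearN.
rewrite !(trD, trN) !trmx_mul.
rewrite !(mulmxDl, mulmxDr, mulNmx, mulmxN) !mulmxA => /matrixP E.
apply/matrixP => i j; have := E i j.
by rewrite !(mxaddE, mxoppE) => {}E; lra.
Qed.

(** By the Bianchi identity the difference of two opposite entries is the trace of a curvature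
    endomorphism, which vanishes because that endomorphism is skew for [g]. *)
Lemma ricci_sym x : U x -> (ricci G x)^T = ricci G x.
Proof.
move=> Ux; apply/matrixP => i j; rewrite mxE !ricciE//.
apply/eqP; rewrite -subr_eq0 -sumrB; apply/eqP.
set ei := delta_mx 0 i; set ej := delta_mx 0 j.
rewrite -[RHS](mxtrace_skew (posdef_unitmx (g_pos Ux)) (riemann_skew ei ej Ux)).
rewrite mxtrace_delta; apply: eq_bigr => k _; set ek := delta_mx 0 k.
have := bianchi ej ei ek Ux.
rewrite (riemannC ei ek) (riemannC ej ei).
move=> /rowP/(_ k); rewrite !mulmxN !(mxaddE, mxoppE) [RHS]mxE => E; lra.
Qed.

End Connection.

(** * Ricci curvature along the Reeb field, in one chart *)

Section ReebField.
Local Open Scope classical_set_scope.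
Context {R : realType} {p : nat} (G : connection_coef R p) (U : set 'rV[R]_p).
Context (g phi : 'rV[R]_p -> 'M[R]_p) (xi : 'rV[R]_p -> 'rV[R]_p).
Local Notation Gamma := (christoffel G).

Hypothesis U_open : open U.
Hypothesis G_smooth : forall i j, smooth_on U (fun x => G x i j).
Hypothesis g_smooth : smooth_on U g.
Hypothesis phi_smooth : smooth_on U phi.
Hypothesis xi_smooth : smooth_on U xi.
Hypothesis torsion_free :
  forall x (u w : 'rV[R]_p), U x -> w *m Gamma u x = u *m Gamma w x.
Hypothesis metric_derive : forall x u, U x ->
  'D_u g x = Gamma u x *m g x + g x *m (Gamma u x)^T.
Hypothesis g_pos : forall x, U x -> forall u, u != 0 -> 0 < pair2 (g x) u u.
Hypothesis nabla_xi : forall x u, U x ->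
  'D_u xi x = - (u *m phi x) - xi x *m Gamma u x.
Hypothesis phi_skew : forall x, U x -> phi x *m g x = - (g x *m (phi x)^T).
Hypothesis xi_phi : forall x, U x -> xi x *m phi x = 0.

(* [u *m nabla_phi w x] is (nabla_w phi)(u) at [x]. *)
Definition nabla_phi (w x : 'rV[R]_p) : 'M[R]_p :=
  'D_w phi x + phi x *m Gamma w x - Gamma w x *m phi x.

(** Second derivatives of [xi] commute; [nabla_xi] expresses both orders through [phi], and
    torsion-freeness cancels the remaining Christoffel terms. *)
Lemma riemann_xi (w u x : 'rV[R]_p) : U x ->
  xi x *m riemann G w u x = w *m nabla_phi u x - u *m nabla_phi w x.
Proof.
move=> Ux.
have D2 a b : 'D_b ('D_a xi) x = - (a *m 'D_b phi x)
    - ((- (b *m phi x) - xi x *m Gamma b x) *m Gamma a x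
       + xi x *m 'D_b (Gamma a) x).
  rewrite (derive_open b U_open Ux (fun y => @nabla_xi y a)) -nabla_xi//.
  have d1 := is_derive_christoffel G_smooth a b Ux.
  have d2 := smooth_on_is_derive b xi_smooth Ux.
  have d3 := smooth_on_is_derive b phi_smooth Ux.
  have [_ ->] := is_deriveB (is_deriveN (is_derive_mulmx (is_derive_cst a x b) d3))
    (is_derive_mulmx d2 d1).
  by rewrite mul0mx add0r.
have := derive_swap u w U_open Ux xi_smooth; rewrite (D2 u w) (D2 w u).
rewrite /riemann /nabla_phi; have := torsion_free w u Ux.
move: ('D_w (Gamma u) x) ('D_u (Gamma w) x) (Gamma u x) (Gamma w x).
move: ('D_u phi x) ('D_w phi x) (xi x) (phi x).
move=> Du Dw y f Dwu Duw Gu Gw uw.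
rewrite !(mulmxDl, mulmxDr, mulNmx, mulmxN) !mulmxA uw => /rowP E.
apply/rowP => k; have := E k; rewrite !(mxaddE, mxoppE) => {}E; lra.
Qed.

Lemma mxtrace_phi x : U x -> \tr (phi x) = 0.
Proof.
by move=> Ux; apply: mxtrace_skew (posdef_unitmx (g_pos Ux)) (phi_skew Ux).
Qed.

(** The Christoffel terms form a commutator, which has trace zero; what remains is the derivative of
    the trace of [phi], which is zero on [U]. *)
Lemma mxtrace_nabla_phi (w x : 'rV[R]_p) : U x -> \tr (nabla_phi w x) = 0.
Proof.
move=> Ux; rewrite /nabla_phi !raddfB raddfD/= mxtrace_mulC addrK.
have [_ <-] := is_derive_mxtrace (smooth_on_is_derive w phi_smooth Ux).
by rewrite (derive_open w U_open Ux mxtrace_phi) derive_cst.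
Qed.

(** Differentiating [xi *m phi = 0] moves the derivative onto [xi], where [nabla_xi] produces the
    second factor [phi]. *)
Lemma xi_nabla_phi (w x : 'rV[R]_p) : U x ->
  xi x *m nabla_phi w x = w *m phi x *m phi x.
Proof.
move=> Ux.
have d2 := smooth_on_is_derive w xi_smooth Ux.
have d3 := smooth_on_is_derive w phi_smooth Ux.
have [_] := is_derive_mulmx d2 d3.
rewrite (derive_open w U_open Ux xi_phi) derive_cst nabla_xi// => /esym.
rewrite /nabla_phi; have := xi_phi Ux.
move: ('D_w phi x) (Gamma w x) (xi x) (phi x) => Dw Gw y f yf.
rewrite !(mulmxDl, mulmxDr, mulNmx, mulmxN) !mulmxA yf mul0mx addr0 => E.
have -> : y *m Dw = w *m f *m f + y *m Gw *m f.
  by apply/eqP; rewrite -subr_eq0 opprD addrC E.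
by rewrite addrK.
Qed.

Lemma delta_mulE (q : nat) (A : 'M[R]_(p, q)) j k :
  (delta_mx 0 j *m A : 'rV_q) 0 k = A j k.
Proof. by rewrite -rowE mxE. Qed.

Lemma ricci_xi_xi x : U x ->
  pair2 (ricci G x) (xi x) (xi x) = - \tr (phi x *m phi x).
Proof.
move=> Ux; pose e k : 'rV[R]_p := delta_mx 0 k.
(* Of the two terms of [riemann_xi], one is traced to zero by [mxtrace_nabla_phi]; the other gives
   minus the divergence of [phi]. *)
have Rx i : (ricci G x *m (xi x)^T) i 0 = - \sum_k nabla_phi (e k) x i k.
  transitivity (\sum_k (xi x *m riemann G (e k) (e i) x) 0 k).
    rewrite mxE; under eq_bigr do rewrite (ricciE G_smooth _ _ Ux) mulr_suml.
    rewrite exchange_big; apply: eq_bigr => k _; rewrite [RHS]mxE.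
    by apply: eq_bigr => j _; rewrite delta_mulE [(xi x)^T _ _]mxE mulrC.
  under eq_bigr do rewrite (riemann_xi _ _ Ux) mxaddE mxoppE !delta_mulE.
  by rewrite sumrB -/(\tr (nabla_phi (e i) x)) mxtrace_nabla_phi// sub0r.
rewrite /pair2 -mulmxA mxE.
(* Contracting the divergence with [xi] brings in [xi_nabla_phi], whose trace over [w] is that of
   the square of [phi]. *)
under eq_bigr do rewrite Rx mulrN mulr_sumr.
rewrite sumrN exchange_big; congr (- _); rewrite mxtrace_delta.
apply: eq_bigr => k _; rewrite mulmxA -xi_nabla_phi// [RHS]mxE.
exact: eq_bigr.
Qed.

Context (Q : 'rV[R]_p -> 'M[R]_p) (eta : 'rV[R]_p -> 'cV[R]_p) (t : R).
Hypothesis g_sym : forall x, U x -> (g x)^T = g x.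
Hypothesis eta_dual : forall x, U x -> eta x = g x *m (xi x)^T.
Hypothesis phi_eta : forall x, U x -> phi x *m eta x = 0.
Hypothesis eta_xi1 : forall x, U x -> xi x *m eta x = 1%:M.
Hypothesis Q_unit : forall x, U x -> Q x \in unitmx.
Hypothesis phi_phi : forall x, U x -> phi x *m phi x = - Q x + eta x *m xi x.
Hypothesis trace_Q : forall x, U x -> \tr (Q x) = 1 + t.
Hypothesis nabla_ricci_xi : forall X Y, smooth_on U X -> smooth_on U Y ->
  forall x, U x -> nabla_ricci G X xi Y x = 0.

(** The 1 that the direction of [xi] adds to the full trace of [Q] cancels against the trace of
    [eta *m xi]. *)
Lemma ricci_xi_xi_cst x : U x -> pair2 (ricci G x) (xi x) (xi x) = t.
Proof.
move=> Ux; rewrite ricci_xi_xi// phi_phi// raddfD raddfN/= trace_Q//.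
by rewrite mxtrace_mulC eta_xi1// mxtrace1; ring.
Qed.

Lemma nabla_cst_xi (u x : 'rV[R]_p) : U x ->
  nabla G (cst u) xi x = - (u *m phi x).
Proof. by move=> Ux; rewrite nablaE nabla_xi// subrK. Qed.

(* The Reeb case of the hypothesis kills [Ric(phi X, xi)], and [phi] maps onto
   the kernel of [eta]. *)
Lemma ricci_xi x : U x -> ricci G x *m (xi x)^T = t *: eta x.
Proof.
move=> Ux; have rs :=
  ricci_sym G_smooth torsion_free U_open g_smooth g_pos metric_derive Ux.
have ph0 : phi x *m (ricci G x *m (xi x)^T) = 0.
  apply: row_mul_inj => u; apply/rowP => j; rewrite ord1 mulmx0 [RHS]mxE.
  have := nabla_ricci_xi (smooth_on_cst U u) xi_smooth Ux.
  rewrite /nabla_ricci /vf_deriv (derive_open _ U_open Ux ricci_xi_xi_cst) derive_cst.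
  rewrite nabla_cst_xi// pair2Nl pair2Nr (pair2C _ _ rs).
  have -> : pair2 (ricci G x) (xi x) (u *m phi x) =
            (u *m (phi x *m (ricci G x *m (xi x)^T))) 0 0.
    by rewrite pair2C// /pair2 !mulmxA.
  by move=> E; lra.
have Qe : Q x *m eta x = eta x.
  apply/eqP; rewrite -subr_eq0 -oppr_eq0 opprB addrC -mulNmx.
  rewrite -[X in _ + X]mulmx1 -(eta_xi1 Ux) mulmxA -mulmxDl -phi_phi//.
  by rewrite -mulmxA phi_eta// mulmx0.
(* Applying [phi] once more to [ph0] and substituting [phi_phi] makes [Q] appear; as [Q] also fixes
   [eta] by [Qe], it can be cancelled. *)
have Qr : Q x *m (ricci G x *m (xi x)^T) = t *: eta x.
  have /eqP := congr1 (mulmx (phi x)) ph0.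
  rewrite mulmx0 mulmxA phi_phi// mulmxDl mulNmx addrC subr_eq0 => /eqP <-.
  rewrite -!mulmxA [X in eta x *m X](_ : _ = t%:M) ?mul_mx_scalar//.
  by apply/eqP; rewrite mx11E mulmxA -(ricci_xi_xi_cst Ux).
by rewrite -[LHS](mulKmx (Q_unit Ux)) Qr -[in LHS]Qe scalemxAr mulKmx// Q_unit.
Qed.

Lemma ricci_einstein x : U x -> ricci G x = t *: g x.
Proof.
move=> Ux.
have xiR y : U y -> xi y *m ricci G y = t *: (xi y *m g y).
  move=> Uy.
  have rsy :=
    ricci_sym G_smooth torsion_free U_open g_smooth g_pos metric_derive Uy.
  rewrite -rsy -[xi y]trmxK -trmx_mul ricci_xi// eta_dual// linearZ/=.
  by rewrite trmx_mul g_sym.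
have phR : phi x *m ricci G x = t *: (phi x *m g x).
  apply: pair2_inj => u v.
  have := nabla_ricci_xi (smooth_on_cst U u) (smooth_on_cst U v) Ux.
  rewrite /nabla_ricci /vf_deriv nabla_cst_xi// nabla_cst/=.
  (* On [U] the differentiated function is [t] times the metric product of [xi] and [v], by [xiR];
     this avoids differentiating [ricci]. *)
  have -> : 'D_u (fun y => pair2 (ricci G y) (xi y) v : R^o) x =
      t * (((- (u *m phi x) - xi x *m Gamma u x) *m g x
        + xi x *m (Gamma u x *m g x + g x *m (Gamma u x)^T)) *m v^T) 0 0.
    rewrite -nabla_xi// -metric_derive//.
    have d2 := smooth_on_is_derive u xi_smooth Ux.
    have d3 := smooth_on_is_derive u g_smooth Ux.
    have d4 := is_derive_mulmx (is_derive_mulmx d2 d3) (is_derive_cst v^T x u).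
    rewrite (derive_open (h := fun y =>
      (t \*: (fun y => (xi y *m g y *m v^T) 0 0)) y) u U_open Ux).
      have d5 := (is_derive_mxP _ _ _ _).1 d4 0 0.
      by have [_ ->] := is_deriveZ t d5; rewrite mulmx0 addr0.
    by move=> y Uy; rewrite /pair2 xiR// -scalemxAl mxE.
  rewrite /pair2 xiR// trmx_mul.
  move: ('D_u xi x) (Gamma u x) (xi x) (phi x) (ricci G x) (g x) => _ Gu y f r h.
  rewrite !(mulmxDl, mulmxDr, mulNmx, mulmxN) !mulmxA.
  rewrite -!(scalemxAl, scalemxAr) !mulmxA !(mxaddE, mxoppE, mxscaleE).
  move=> E; lra.
(* Both [phi] and [xi] annihilate [ricci - t *: g] from the left, hence so does [Q], by [phi_phi];
   and [Q] is invertible. *)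
apply/eqP; rewrite -subr_eq0; apply/eqP.
rewrite -[LHS](mulKmx (Q_unit Ux)).
suff -> : Q x *m (ricci G x - t *: g x) = 0 by rewrite mulmx0.
apply/eqP; rewrite -oppr_eq0 -mulNmx.
have -> : - Q x = phi x *m phi x - eta x *m xi x by rewrite phi_phi// addrK.
by rewrite mulmxBl -!mulmxA !mulmxBr phR xiR// -!scalemxAr !subrr.
Qed.

End ReebField.

(* [xi *m phi] vanishes because [phi] kills it, whereas [phi^2] is injective on
   [ker eta]. *)
Lemma weak_almost_contact_algebra (R : realType) (p : nat) (phi Q : 'M[R]_p)
    (xi : 'rV[R]_p) (eta : 'cV[R]_p) :
  Q \in unitmx -> xi *m eta = 1%:M -> xi *m Q = xi ->
  phi *m phi = - Q + eta *m xi ->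
  (forall u : 'rV_p, u *m eta = 0 -> u *m phi *m eta = 0) ->
  xi *m phi = 0 /\ phi *m eta = 0.
Proof.
move=> Qu xe xQ pp ker.
have xpp : xi *m phi *m phi = 0.
  by rewrite -mulmxA pp mulmxDr mulmxN xQ mulmxA xe mul1mx addNr.
pose a := (xi *m phi *m eta) 0 0.
have aE : xi *m phi *m eta = a%:M by rewrite [LHS]mx11_scalar.
(* The vector [xi *m phi - a *: xi] lies in the kernel of [eta], and [phi] sends it to
   [- a *: (xi *m phi)]; invariance of the kernel then says that the square of [a] vanishes. *)
have a0 : a = 0.
  have := ker (xi *m phi - a *: xi).
  rewrite !mulmxBl -!scalemxAl xe aE scalemx1 subrr => /(_ erefl).
  rewrite xpp mul0mx sub0r => /matrixP/(_ 0 0)/eqP.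
  by rewrite !mxE eqxx mulr1n oppr_eq0 mulf_eq0 orbb => /eqP.
have xpe : xi *m phi *m eta = 0 by rewrite aE a0 raddf0.
have xp : xi *m phi = 0.
  have : xi *m phi *m (phi *m phi) = 0 by rewrite mulmxA xpp mul0mx.
  rewrite pp mulmxDr mulmxN mulmxA xpe mul0mx addr0 => /eqP.
  by rewrite oppr_eq0 => /eqP xpQ; rewrite -[LHS](mulmxK Qu) xpQ mul0mx.
split=> //; apply: row_mul_inj => u; rewrite mulmx0 mulmxA.
(* Projecting [u] to the kernel of [eta] along [xi] does not change its image under [phi], since
   [phi] kills [xi]. *)
have := ker (u - u *m eta *m xi); rewrite !mulmxBl -!mulmxA xe mulmx1 subrr.
by move=> /(_ erefl); rewrite (mulmxA xi) xp mul0mx !mulmx0 subr0.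
Qed.

(** * From the invariant conditions to matrix identities in a chart *)

Section Chart.
Local Open Scope classical_set_scope.
Context {R : realType} {m : nat} {M : topologicalType} (A : smooth_manifold R m M).

Lemma levi_civita_torsion_free (g : riemannian_metric A) G (c : chart A) x u w :
  levi_civita g G -> chart_range c x ->
  w *m christoffel (G c) u x = u *m christoffel (G c) w x.
Proof.
move=> /(_ c)[_ /(_ (cst u) (cst w) 0)] LC Ux.
have [+ _] := LC (smooth_on_cst _ u) (smooth_on_cst _ w) (smooth_on_cst _ 0) x Ux.
rewrite lie_bracket_cst !nabla_cst => /eqP; rewrite subr_eq0 => /eqP.
exact.
Qed.

Lemma levi_civita_metric (g : riemannian_metric A) G (c : chart A) x u :
  levi_civita g G -> chart_range c x ->
  'D_u (g c) x = christoffel (G c) u x *m g c x + g c x *m (christoffel (G c) u x)^T.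
Proof.
move=> /(_ c)[_ LC] Ux; apply: pair2_inj => v w.
have [_ ] := LC (cst u) (cst v) (cst w) (smooth_on_cst _ u) (smooth_on_cst _ v)
  (smooth_on_cst _ w) x Ux.
rewrite !nabla_cst /vf_deriv/=.
have d1 := smooth_on_is_derive u (comp_smooth g c) Ux.
have d2 := is_derive_mulmx (is_derive_mulmx (is_derive_cst v x u) d1)
  (is_derive_cst w^T x u).
have [_ ->] := (is_derive_mxP _ _ _ _).1 d2 0 0.
rewrite /pair2 mul0mx add0r mulmx0 addr0 => ->.
by rewrite trmx_mul mulmxDr mulmxDl mxaddE !mulmxA.
Qed.

End Chart.

(** In each chart, the structure is tested on constant fields to obtain the matrix identities that
    [ricci_einstein] assumes. The constant [t] is the same in all charts. *)
Lemma weak_K_contact_einstein (R : realType) (m : nat) (M : topologicalType)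
    (A : smooth_manifold R m.+1 M) (phi Q : endo_field A) (xi : vector_field A)
    (eta : one_form A) (g : riemannian_metric A)
    (G : chart A -> connection_coef R m.+1) (t : R) :
  weak_K_contact phi Q xi eta g ->
  levi_civita g G ->
  (forall (c : chart A) (X Y : 'rV[R]_m.+1 -> 'rV[R]_m.+1),
     smooth_on (chart_range c) X -> smooth_on (chart_range c) Y ->
     forall x, chart_range c x -> nabla_ricci (G c) X (xi c) Y x = 0) ->
  (forall (c : chart A) x, chart_range c x ->
     is_trace_on_ker (g c x) (Q c x) (eta c x) t) ->
  forall (c : chart A) x, chart_range c x -> ricci (G c) x = t *: g c x.
Proof.
move=> Kc LC ricxi trQ c; set U := chart_range c.
have Uo : open U by exact: range_open.
have wac := wacm_wac (wcm_wacm (wKc_wcm Kc)).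
have gsym x : U x -> (g c x)^T = g c x.
  move=> Ux; apply: pair2_inj => u v.
  by rewrite -(Defs.metric_sym g Ux) /pair2 mulmx_trC trmx_mul mulmxA trmxK.
have pos := @Defs.metric_pos _ _ _ _ g c.
have Qu x : U x -> Q c x \in unitmx by exact: Q_nonsingular wac _ _.
have xe x : U x -> xi c x *m eta c x = 1%:M.
  by move=> Ux; apply/eqP; rewrite mx11E; apply/eqP; apply: (eta_xi wac).
have xQ x : U x -> xi c x *m Q c x = xi c x by exact: (Q_xi wac).
have pp x : U x -> phi c x *m phi c x = - Q c x + eta c x *m xi c x.
  move=> Ux; apply: row_mul_inj => u; rewrite mulmxA (phi_sq wac Ux).
  rewrite mulmxDr mulmxN; congr (_ + _).
  by rewrite mulmxA [u *m eta c x]mx11_scalar mul_scalar_mx.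
have alg x : U x -> xi c x *m phi c x = 0 /\ phi c x *m eta c x = 0.
  move=> Ux.
  apply: weak_almost_contact_algebra (Qu x Ux) (xe x Ux) (xQ x Ux) (pp x Ux) _.
  move=> u /matrixP/(_ 0 0); rewrite [X in _ = X -> _]mxE => u0.
  by rewrite [LHS]mx11_scalar [X in X%:M](phi_ker_eta wac Ux u0) raddf0.
(* Metric compatibility with second argument [xi]: the left side vanishes as [phi] kills [xi]. *)
have dual x : U x -> eta c x = g c x *m (xi c x)^T.
  move=> Ux; have [x0 _] := alg x Ux; apply: row_mul_inj => u.
  have := metric_compat (wcm_wacm (wKc_wcm Kc)) Ux u (xi c x).
  rewrite x0 xQ// (eta_xi wac)// mulr1 /pair2 trmx0 mulmx0 mxE => /eqP.
  rewrite eq_sym subr_eq0 => /eqP E; rewrite mulmxA.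
  by rewrite [RHS]mx11_scalar E -mx11_scalar.
have tors x u w := @levi_civita_torsion_free R _ M A g G c x u w LC.
have Dg x u := @levi_civita_metric R _ M A g G c x u LC.
(* [B u x] is the covariant derivative of [xi] in the direction [u]. The Killing condition makes it
   skew, and the contact condition then identifies it. *)
pose B u x := 'D_u (xi c) x + xi c x *m christoffel (G c) u x.
have D_pair2 x u v w :  U x -> pair2 ('D_u (g c) x) v w =
    pair2 (g c x) (v *m christoffel (G c) u x) w +
    pair2 (g c x) v (w *m christoffel (G c) u x).
  by move=> Ux; rewrite Dg// /pair2 trmx_mul mulmxDr mulmxDl mxaddE !mulmxA.
(* For constant fields the Lie derivative of [g] along [xi] is the symmetrised form of [B], once
   torsion-freeness exchanges the Christoffel terms. *)
have Bskew x u v : U x -> pair2 (g c x) (B u x) v = - pair2 (g c x) (B v x) u.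
  move=> Ux; have := reeb_killing Kc (smooth_on_cst _ u) (smooth_on_cst _ v) Ux.
  rewrite /lie_deriv2 /vf_deriv !lie_bracket_cstr/=.
  have d1 := smooth_on_is_derive (xi c x) (comp_smooth g c) Ux.
  have d2 := is_derive_mulmx (is_derive_mulmx (is_derive_cst u x (xi c x)) d1)
    (is_derive_cst v^T x (xi c x)).
  have [_ ->] := (is_derive_mxP _ _ _ _).1 d2 0 0.
  rewrite mul0mx add0r mulmx0 addr0 -/(pair2 _ _ _) D_pair2//.
  rewrite pair2Nl pair2Nr (tors x (xi c x) u Ux) (tors x (xi c x) v Ux).
  rewrite !(pair2C u _ (gsym x Ux)) /B !pair2Dl.
  by do 4 move: (pair2 _ _ _) => ?; rewrite opprK; lra.
(* By duality the exterior derivative of [eta] is the skew part of the bilinear form of [B]; by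
   [Bskew] this is the whole form. *)
have contact x u v : U x ->
    pair2 (g c x) u (v *m phi c x) = pair2 (g c x) (B u x) v.
  move=> Ux.
  rewrite (contact_form (wKc_wcm Kc) (smooth_on_cst _ u) (smooth_on_cst _ v) Ux).
  have D_eta a b : 'D_b (fun y => pair1 (eta c y) a : R^o) x =
      pair2 (g c x) (a *m christoffel (G c) b x) (xi c x) + pair2 (g c x) a (B b x).
    rewrite (derive_open (h := fun y => pair2 (g c y) a (xi c y)) b Uo Ux); last first.
      by move=> y Uy; rewrite /pair1 /pair2 dual// mulmxA.
    have d1 := smooth_on_is_derive b (comp_smooth g c) Ux.
    have d2 := smooth_on_is_derive b (comp_smooth xi c) Ux.
    have d3 := is_derive_mulmx (is_derive_mulmx (is_derive_cst a x b) d1)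
      (is_derive_trmx d2).
    have [_ ->] := (is_derive_mxP _ _ _ _).1 d3 0 0.
    rewrite mul0mx add0r mxaddE -/(pair2 _ _ _) D_pair2// -/(pair2 _ _ _).
    by rewrite /B pair2Dr; do 3 move: (pair2 _ _ _) => ?; ring.
  rewrite /ext_deriv /vf_deriv lie_bracket_cst D_eta D_eta.
  rewrite /pair1 mul0mx mxE (tors x u v Ux) (pair2C v _ (gsym x Ux)).
  rewrite (pair2C u (B v x) (gsym x Ux)) (Bskew x v u Ux).
  by do 2 move: (pair2 _ _ _) => ?; field.
(* Skewness and [contact] give equal metric products with every [v]; nondegeneracy of [g]
   concludes. *)
have Bphi x u : U x -> B u x = - (u *m phi c x).
  move=> Ux; apply: (can_inj (mulmxK (posdef_unitmx (pos x Ux)))).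
  apply: pair2_row_inj => v; rewrite -/(pair2 _ _ _) -/(pair2 _ _ _).
  by rewrite Bskew// -contact// pair2Nl (pair2C _ _ (gsym x Ux)).
have nxi x u : U x ->
    'D_u (xi c) x = - (u *m phi c x) - xi c x *m christoffel (G c) u x.
  by move=> Ux; rewrite -Bphi// /B addrK.
have skew x : U x -> phi c x *m g c x = - (g c x *m (phi c x)^T).
  move=> Ux; apply: pair2_inj => u v.
  rewrite {1}/pair2 mulmxA -/(pair2 _ _ _) -[LHS]opprK -pair2Nl -Bphi// -contact//.
  by rewrite /pair2 mulmxN mulNmx mxoppE trmx_mul !mulmxA.
have xphi x : U x -> xi c x *m phi c x = 0 by move=> /alg[].
have phieta x : U x -> phi c x *m eta c x = 0 by move=> /alg[].
have tQ x : U x -> \tr (Q c x) = 1 + t.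
  move=> Ux.
  apply: trace_on_ker (pos x Ux) (gsym x Ux) (dual x Ux) (xe x Ux) (xQ x Ux) _.
  exact: trQ.
exact (@ricci_einstein _ _ _ _ _ _ _ Uo (LC c).1 (comp_smooth g c)
  (comp_smooth phi c) (comp_smooth xi c) tors Dg pos nxi skew xphi _ _ _
  gsym dual phieta xe Qu pp tQ (ricxi c)).
Qed.

Theorem theorem4p1 (R : realType) (n : nat) (M : topologicalType)
    (A : smooth_manifold R (n.*2).+1 M)
    (phi Q : endo_field A) (xi : vector_field A) (eta : one_form A)
    (g : riemannian_metric A)
    (G : chart A -> connection_coef R (n.*2).+1) (trQ : R) :
  weak_K_contact phi Q xi eta g ->
  levi_civita g G ->
  (forall (c : chart A) (X Y : 'rV[R]_(n.*2).+1 -> 'rV[R]_(n.*2).+1),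
     smooth_on (chart_range c) X -> smooth_on (chart_range c) Y ->
     forall x, chart_range c x -> nabla_ricci (G c) X (xi c) Y x = 0) ->
  (forall (c : chart A) x, chart_range c x ->
     is_trace_on_ker (g c x) (Q c x) (eta c x) trQ) ->
  einstein g G /\
  (forall (c : chart A) x, chart_range c x ->
     scalar_curvature (G c) (g c) x = (n.*2).+1%:R * trQ).
Proof.
move=> Kc LC ricxi tr; have E := weak_K_contact_einstein Kc LC ricxi tr.
split=> [|c x Ux]; first by exists trQ.
have gu := posdef_unitmx (Defs.metric_pos g Ux).
rewrite /scalar_curvature E// -scalemxAr mulVmx// scalemx1 mxtrace_scalar.
by rewrite mulr_natl.
Qed.
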